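(* Let $m \ge 1$ be a fixed integer and let $G_m^n$ be the preferential attachment random multigraph. For any $\varepsilon > 0$, asymptotically almost surely (as $n\to\infty$) $$ q^*(G_m^n) \ge \frac{1}{m} - O\left(n^{-1/4+\varepsilon}\right) = \frac{1}{m} - o(1). $$ That is, there is a constant $C = C(m,\varepsilon)$ such that with probability tending to $1$ as $n\to\infty$, $q^*(G_m^n) \ge \frac1m - C n^{-1/4+\varepsilon}$.
   Context: Preferential attachment model. Let $G_1^0$ be the null graph with no vertices. The process $(G_1^t)_{t\ge 0}$ is defined inductively: given $G_1^{t-1}$, form $G_1^t$ by adding a vertex $v_t$ together with a single edge between $v_t$ and $v_i$, where $i$ is chosen randomly with $\mathbb{P}(i=s) = \deg(v_s,t-1)/(2t-1)$ for $1\le s\le t-1$ and $\mathbb{P}(i=t) = 1/(2t-1)$; here $\deg(v_s,t-1)$ is the degree of $v_s$ in $G_1^{t-1}$ (loops counted twice). For $m\ge 2$, $G_m^t$ is obtained from $G_1^{tm}$, on vertices $v'_1,v'_2,\dots,v'_{tm}$, by identifying $v'_{(j-1)m+1},\dots,v'_{jm}$ to form the vertex $v_j$, for each $1\le j\le t$. $G_m^n$ is in general a multigraph with $mn$ edges, possibly with loops and multiple edges. Modularity: for a (multi)graph $G$ with at least one edge and a partition $\mathcal{A}$ of $V(G)$, $$q_{\mathcal{A}}(G) = \sum_{A \in \mathcal{A}} \left( \frac{e(A)}{|E(G)|} - \frac{(\sum_{v\in A}\deg(v))^2}{4|E(G)|^2}\right),$$ where $e(A)$ is the number of edges (counted with multiplicity,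 loops included) with both endpoints in $A$ and loops contribute $2$ to degrees. The modularity is $q^*(G) = \max_{\mathcal{A}} q_{\mathcal{A}}(G)$ over all partitions $\mathcal{A}$ of $V(G)$. An event holds asymptotically almost surely if its probability tends to $1$ as $n\to\infty$. *)

(* Defs.v *)
From HB Require Import structures.
From mathcomp Require Import all_boot all_order all_algebra.
From mathcomp Require Import all_classical all_reals all_analysis.

Set Implicit Arguments.
Unset Strict Implicit.
Unset Printing Implicit Defensive.

Import Order.TTheory GRing.Theory Num.Theory.
Import numFieldNormedType.Exports.

Local Open Scope ring_scope.

(* A finite multigraph on the vertex set V, given by the list of its edges.
   The order of the two endpoints of an edge plays no role; (v, v) is a loop,
   and parallel edges are repeated entries. *)
Definition mgraph (V : finType) := seq (V * V).

Definition mdeg (V : finType) (G : mgraph V) (v : V) : nat :=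
  (\sum_(e <- G) ((e.1 == v) + (e.2 == v)))%N.

Definition edges_in (V : finType) (G : mgraph V) (A : {set V}) : nat :=
  count (fun e => (e.1 \in A) && (e.2 \in A)) G.

Definition modularity_of (R : realType) (V : finType) (G : mgraph V)
    (P : {set {set V}}) : R :=
  \sum_(A in P) ((edges_in G A)%:R / (size G)%:R
                 - (\sum_(v in A) mdeg G v)%N%:R ^+ 2
                   / (4 * (size G)%:R ^+ 2)).

Definition singletons (V : finType) : {set {set V}} :=
  [set [set v]%SET | v in [set: V]]%SET.

(* The default value of the big operator is the score of a partition, so this
   is a genuine maximum over all partitions, see modularityP. Edgeless graphs
   get modularity 0, since x / 0 = 0. *)
Definition modularity (R : realType) (V : finType) (G : mgraph V) : R :=
  \big[Num.max/modularity_of R G (singletons V)]_(P : {set {set V}}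
      | finset.partition P [set: V]%SET) modularity_of R G P.

Lemma singletons_partition (V : finType) :
  finset.partition (singletons V) [set: V]%SET.
Proof.
apply/and3P; split.
- apply/eqP/setP=> v; rewrite finset.in_setT; apply/bigcupP.
  by exists [set v]%SET; rewrite ?finset.in_set1 ?eqxx //; apply/imsetP; exists v.
- apply/finset.trivIsetP=> _ _ /imsetP[x _ ->] /imsetP[y _ ->] nxy.
  rewrite disjoints1 finset.in_set1; apply: contraNN nxy.
  by move=> /eqP ->.
- apply/imsetP=> -[v _ /setP/(_ v)].
  by rewrite finset.in_set0 finset.in_set1 eqxx.
Qed.

Lemma modularityP (R : realType) (V : finType) (G : mgraph V) :
  (exists2 P, finset.partition P [set: V]%SET
              & modularity R G = modularity_of R G P)
  /\ (forall P, finset.partition P [set: V]%SET ->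
        modularity_of R G P <= modularity R G).
Proof.
split; last by move=> P hP; apply: (le_bigmax_cond _ (modularity_of R G) hP).
rewrite /modularity.
apply: (big_ind (fun x => exists2 P, finset.partition P [set: V]%SET
                                     & x = modularity_of R G P)).
- by exists (singletons V) => //; exact: singletons_partition.
- move=> x y [P hP ->] [Q hQ ->]; rewrite maxEle.
  by case: ifP => _; [exists Q | exists P].
- by move=> P hP; exists P.
Qed.

(* The successive random choices in the construction of G_1^t. Vertices are
   numbered from 0: passing from G_1^t to G_1^(t+1) adds the vertex
   ord_max : 'I_t.+1, whose edge goes to the last component of the choice. *)
Fixpoint pa_choices (t : nat) : finType :=
  if t is t'.+1 then (pa_choices t' * 'I_t'.+1)%type : finType
  else unit : finType.

Fixpoint pa_graph1 (t : nat) : pa_choices t -> mgraph 'I_t :=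
  match t return pa_choices t -> mgraph 'I_t with
  | 0 => fun=> [::]
  | t'.+1 => fun h : pa_choices t' * 'I_t'.+1 =>
      (ord_max, h.2)
        :: [seq (lift ord_max e.1, lift ord_max e.2) | e <- pa_graph1 h.1]
  end.

(* The conditional law of the endpoint i chosen by the new vertex ord_max,
   given the current graph G; the new graph has t.+1 vertices, so that the
   denominator is 2 * t.+1 - 1. *)
Definition pa_step (R : realType) (t : nat) (G : mgraph 'I_t)
    (i : 'I_t.+1) : R :=
  (if unlift ord_max i is Some s then (mdeg G s)%:R else 1)
  / (2 * t + 1)%N%:R.

Fixpoint pa_weight (R : realType) (t : nat) : pa_choices t -> R :=
  match t return pa_choices t -> R with
  | 0 => fun=> 1
  | t'.+1 => fun h : pa_choices t' * 'I_t'.+1 =>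
      pa_weight R h.1 * pa_step R (pa_graph1 h.1) h.2
  end.

Definition pa_Pr (R : realType) (t : nat) (E : pred (pa_choices t)) : R :=
  \sum_(h | E h) pa_weight R h.

Lemma block_subproof (m n : nat) (i : 'I_(n * m)) : (i %/ m < n)%N.
Proof.
by case: m i => [|m] [i hi] /=; [rewrite muln0 in hi | rewrite ltn_divLR].
Qed.

Definition block (m n : nat) (i : 'I_(n * m)) : 'I_n :=
  Ordinal (block_subproof i).

(* G_m^n; for m = 1 the identification of vertices is trivial. *)
Definition pa_graph (m n : nat) (h : pa_choices (n * m)) : mgraph 'I_n :=
  [seq (block e.1, block e.2) | e <- pa_graph1 h].

(* The event E n, about G_m^n, holds asymptotically almost surely. *)
Definition pa_aas (R : realType) (m : nat)
    (E : forall n : nat, pred (pa_choices (n * m))) : Prop :=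
  ((fun n : nat => pa_Pr R (E n)) @ \oo --> (1 : R))%classic.

Lemma size_pa_graph1 (t : nat) (h : pa_choices t) : size (pa_graph1 h) = t.
Proof. by elim: t h => //= t IH [h i] /=; rewrite size_map IH. Qed.

Lemma sum_mdeg (V : finType) (G : mgraph V) :
  (\sum_v mdeg G v = 2 * size G)%N.
Proof.
rewrite /mdeg exchange_big /= (eq_bigr (fun=> 2%N)) => [|e _].
  by rewrite big_const_seq count_predT iter_addn_0.
have one (x : V) : (\sum_v (x == v) = 1)%N.
  rewrite (bigD1 x) //= eqxx big1 ?addn0 // => v /negbTE.
  by rewrite eq_sym => ->.
by rewrite big_split /= !one.
Qed.

Lemma pa_weight_ge0 (R : realType) (t : nat) (h : pa_choices t) :
  0 <= pa_weight R h.
Proof.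
elim: t h => //= t IH [h i] /=; rewrite mulr_ge0 // divr_ge0 //.
by case: unlift.
Qed.

Lemma pa_Pr_setT (R : realType) (t : nat) :
  pa_Pr R (fun _ : pa_choices t => true) = 1.
Proof.
rewrite /pa_Pr; elim: t => [|t IH] /=; first by rewrite (big_pred1 tt) // => -[].
rewrite -(pair_big xpredT xpredT (fun h i =>
  pa_weight R h * pa_step R (pa_graph1 h) i)) /= -[RHS]IH.
apply: eq_bigr => h _; rewrite -mulr_sumr -[RHS]mulr1; congr (_ * _).
rewrite -mulr_suml big_ord_recr /= unlift_none.
rewrite (eq_bigr (fun s => (mdeg (pa_graph1 h) s)%:R)) => [|s _]; last first.
  have -> : widen_ord (leqnSn t) s = lift ord_max s.
    by apply/val_inj; rewrite /= /bump leqNgt ltn_ord.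
  by rewrite liftK.
by rewrite -natr_sum sum_mdeg size_pa_graph1 natr1 addn1 divff ?pnatr_eq0.
Qed.

(* Main.v *)
Require Import Defs.
From mathcomp Require Import all_boot all_order all_algebra.
From mathcomp Require Import all_classical all_reals all_analysis.
From mathcomp Require Import ring lra zify.
Set Implicit Arguments.
Unset Strict Implicit.
Unset Printing Implicit Defensive.

Import Order.TTheory GRing.Theory Num.Theory.
Import numFieldNormedType.Exports.
Local Open Scope ring_scope.

(** In G_m^n every vertex v sends the first of its m edges to a vertex
    p v <= v, so G_m^n contains a forest, with loops at its roots, that has n
    of the n * m edges. Suppose that all degrees are at most d. Visiting the
    vertices from the last to the first, merge each vertex into its parent
    unless it is a root or has already gathered degree sum s. Each cut uses up degree s,
    so at most 2nm/s forest edges are cut; a part consists of one vertex and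
    at most d branches of degree sum below s, so its degree sum is at most
    (1 + s) * d [forest_cutting]. Edges within parts then contribute at least
    1/m - 2/s to the modularity and the degree tax is at most
    (1 + s) * d / (2nm) [modularity_forest_ge].

    To bound the degrees, take the sum over the vertices of the rising
    factorial d (d + 1) ... (d + k - 1) divided by k!. As a vertex of degree d
    is hit with probability proportional to d, the conditional expectation of
    this sum after one step is exactly a multiple of it plus a bounded
    contribution of the new vertex, the factor being 1 + k / (2t + 1)
    [pa_E_moment_step]. For even k the product of these factors telescopes to
    a polynomial in t of degree k / 2 [pa_E_moment_le], so the expectation is
    O(t^(k/2 + 1)), and Markov's inequality with k large in terms of e shows
    that all degrees are below n^(1/2 + 2e) with probability 1 - O(1/n)
    [pa_maxdeg_tail]. With s close to n^(1/4 - e), both error terms above are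
    O(n^(-1/4 + e)) [pa_modularity_ge]. *)

(** * Cutting a forest into parts of bounded weight *)

(** The parent function p describes a forest on 0, ..., n - 1, with roots
    p v = v, and r labels the parts. The induction removes the last vertex n,
    which is a leaf. It becomes a part of its own if it is a root, or if it
    weighs at least s, which pays for cutting its edge; otherwise its weight is
    moved to its parent. In the hypothesis on B each remaining child reserves
    the weight s, which it releases when it is merged, so the hypothesis
    survives the move. *)
Lemma forest_cutting (s B n : nat) (p w : nat -> nat) :
  (forall v, v < n -> p v <= v)%N ->
  (forall v, v < n -> w v + s * \sum_(u < n) (p u == v) <= B)%N ->
  exists r : nat -> nat,
    [/\ (forall v, v < n -> r v <= v)%N,
        (forall a, \sum_(v < n) (r v == a) * w v <= B)%N
      & (s * \sum_(v < n) (r v != r (p v)) <= \sum_(v < n) w v)%N].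
Proof.
elim: n w => [|n IHn] w le_p le_w.
  by exists id; split=> // [a|]; rewrite !big_ord0 ?muln0.
have le_p' v : (v < n -> p v <= v)%N by move=> /ltnW; exact: le_p.
(* In both cases the labels below n come from the forest without n, and n
   receives some label L. *)
have extend (L : nat) (r : nat -> nat) :
    (L <= n)%N -> (forall v, v < n -> r v <= v)%N ->
    let r' v := if v == n then L else r v in
    [/\ (forall v, v < n.+1 -> r' v <= v)%N,
        (forall a (f : nat -> nat), \sum_(v < n.+1) (r' v == a) * f v
           = \sum_(v < n) (r v == a) * f v + (L == a) * f n)%N
      & (\sum_(v < n.+1) (r' v != r' (p v))
           = \sum_(v < n) (r v != r (p v)) + (L != r' (p n)))%N].
  move=> leL ler r'; have r'E v : (v < n)%N -> r' v = r v.
    by rewrite /r' => lt; rewrite ltn_eqF.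
  have r'n : r' n = L by rewrite /r' eqxx.
  split.
  - move=> v; rewrite ltnS leq_eqVlt => /orP[/eqP->|lt]; first by rewrite r'n.
    by rewrite r'E // ler.
  - move=> a f; rewrite big_ord_recr /= r'n; congr (_ + _)%N.
    by apply: eq_bigr => v _; rewrite r'E.
  - rewrite big_ord_recr /= r'n; congr (_ + _)%N.
    apply: eq_bigr => v _; rewrite !r'E //.
    exact: leq_ltn_trans (le_p' _ (ltn_ord v)) (ltn_ord v).
have keep : (forall v, v < n -> w v + s * \sum_(u < n) (p u == v) <= B)%N.
  move=> v lt; apply: leq_trans (le_w v (ltnW lt)).
  by rewrite leq_add2l leq_mul2l big_ord_recr leq_addr orbT.
have wn_le : (w n <= B)%N by apply: leq_trans (le_w n (ltnSn n)); exact: leq_addr.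
have isolate : (p n = n \/ s <= w n)%N -> exists r : nat -> nat,
    [/\ (forall v, v < n.+1 -> r v <= v)%N,
        (forall a, \sum_(v < n.+1) (r v == a) * w v <= B)%N
      & (s * \sum_(v < n.+1) (r v != r (p v)) <= \sum_(v < n.+1) w v)%N].
  move=> h; have [r [ler sumr cutr]] := IHn w le_p' keep.
  have [r'1 r'2 r'3] := extend n r (leqnn n) ler.
  exists (fun v => if v == n then n else r v); split=> // [a|].
    rewrite r'2; case: (eqVneq n a) => [<-|_]; last by rewrite addn0.
    rewrite big1 ?add0n ?mul1n // => v _.
    by rewrite ltn_eqF //; apply: leq_ltn_trans (ler _ (ltn_ord v)) (ltn_ord v).
  rewrite r'3 mulnDr [X in (_ <= X)%N]big_ord_recr leq_add //=.
  case: h => [->|]; first by rewrite eqxx /= eqxx muln0.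
  by case: (n != _) => //=; rewrite ?muln1 ?muln0.
case: (eqVneq (p n) n) => [?|pn_neq]; first by apply: isolate; left.
case: (leqP s (w n)) => [?|wn_lt]; first by apply: isolate; right.
have pn_lt : (p n < n)%N by rewrite ltn_neqAle pn_neq le_p.
pose w' v := (w v + (v == p n) * w n)%N.
have sum_w' (a : pred nat) :
    (\sum_(v < n) a v * w' v = \sum_(v < n) a v * w v + a (p n) * w n)%N.
  rewrite /w' (eq_bigr (fun v : 'I_n => a v * w v + a v * ((val v == p n) * w n)))%N.
    rewrite big_split /=; congr (_ + _)%N.
    rewrite (bigD1 (Ordinal pn_lt)) //= eqxx mul1n big1 ?addn0 // => v.
    by rewrite -val_eqE /= => /negbTE->; rewrite muln0.
  by move=> v _; rewrite mulnDr.
have [|r [ler sumr cutr]] := IHn w' le_p'.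
  move=> v lt; have := le_w v (ltnW lt); rewrite big_ord_recr /= mulnDr.
  apply: leq_trans; rewrite /w' -addnA leq_add2l addnC leq_add2l eq_sym.
  case: (p n == v); last by rewrite mul0n.
  by rewrite mul1n muln1; exact: ltnW.
have rpn : (r (p n) <= n)%N by apply: leq_trans (ler _ pn_lt) (ltnW pn_lt).
have [r'1 r'2 r'3] := extend (r (p n)) r rpn ler.
exists (fun v => if v == n then r (p n) else r v); split=> // [a|].
  by rewrite r'2 -(sum_w' (fun v => r v == a)).
rewrite r'3 (ltn_eqF pn_lt) eqxx addn0; apply: leq_trans cutr _.
have := sum_w' xpredT; rewrite mul1n.
rewrite (eq_bigr (fun v : 'I_n => w' v)) => [->|v _]; last by rewrite mul1n.
by rewrite [X in (_ <= X)%N]big_ord_recr /= leq_add2r leq_sum // => v _; rewrite mul1n.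
Qed.

(** * Modularity of a multigraph containing a forest *)

Lemma count_enum (T : finType) (a : pred T) : count a (enum T) = (\sum_x a x)%N.
Proof.
rewrite -sum1_count big_mkcond /= big_enum /=.
by apply: eq_bigr => x _; case: (a x).
Qed.

(** The counting hypothesis says that the multiset of the edges (v, p v) is
    contained in that of the edges of G. The forest is cut with the degrees
    as weights; the degree tax is at most the largest degree sum of a part
    times the total degree 2 * size G. *)
Lemma modularity_forest_ge (R : realType) (n : nat) (G : mgraph 'I_n)
    (p : 'I_n -> 'I_n) (D s : nat) :
  (0 < s)%N -> (0 < size G)%N ->
  (forall v, p v <= v)%N ->
  (forall a : pred ('I_n * 'I_n),
     count a [seq (v, p v) | v <- enum 'I_n] <= count a G)%N ->
  (forall v, mdeg G v <= D)%N ->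
  n%:R / (size G)%:R - 2 / s%:R - (1 + s%:R) * D%:R / (2 * (size G)%:R)
    <= modularity R G.
Proof.
case: n G p => [|n] G p s_gt0 M_gt0 p_le p_sub degD.
  by case: G M_gt0 {p_sub degD} => // -[[]].
pose B := (D + s * D)%N.
have children v : (\sum_(u < n.+1) (p u == v) <= mdeg G v)%N.
  have := p_sub (fun e => e.2 == v); rewrite count_map count_enum => /leq_trans; apply.
  rewrite -sum1_count big_mkcond /mdeg; apply: leq_sum => e _.
  by case: (e.2 == v); rewrite ?leq_addl.
have [|v lt|r [_ volB cuts]] := forest_cutting (s := s) (B := B) (n := n.+1)
    (p := fun i => p (inord i)) (w := fun i => mdeg G (inord i)).
- by move=> v lt; have := p_le (inord v); rewrite inordK.
- rewrite leq_add // leq_mul2l (leq_trans _ (degD (inord v))) ?orbT //.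
  apply: leq_trans (children (inord v)).
  by apply: leq_sum => u _; rewrite inord_val -val_eqE /= inordK.
pose f (v : 'I_n.+1) := r v.
pose P := preim_partition f [set: 'I_n.+1]%SET.
have partP : finset.partition P [set: 'I_n.+1]%SET by exact: preim_partitionP.
have blockP (x y : 'I_n.+1) : (y \in finset.pblock P x) = (f x == f y).
  rewrite pblock_equivalence_partition ?finset.in_setT //.
  by move=> a b c _ _ _; split=> // /eqP ->.
have sum_vol : (\sum_(A in P) \sum_(v in A) mdeg G v = 2 * size G)%N.
  rewrite -sum_mdeg -(set_partition_big _ partP) /=.
  by apply: eq_bigl => v; rewrite finset.in_setT.
have vol_le (A : {set 'I_n.+1}) : A \in P -> (\sum_(v in A) mdeg G v <= B)%N.
  move=> AP; have /set0Pn[x xA] : A != finset.set0.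
    by apply: contraTneq AP => ->; case/and3P: partP.
  have <- : finset.pblock P x = A by apply: def_pblock => //; case/and3P: partP.
  apply: leq_trans (volB (f x)); rewrite big_mkcond.
  apply: leq_sum => v _; rewrite blockP inord_val eq_sym.
  by case: eqP => _; rewrite ?mul1n.
have edges_ge : (n.+1 <= \sum_(A in P) edges_in G A
                   + \sum_(v < n.+1) (f v != f (p v)))%N.
  apply: (@leq_trans (count (fun e => f e.1 == f e.2) G
                        + \sum_(v < n.+1) (f v != f (p v)))%N).
    have := p_sub (fun e => f e.1 == f e.2); rewrite count_map count_enum /= => h.
    apply: leq_trans (leq_add h (leqnn _)); rewrite -big_split /=.
    by rewrite (eq_bigr (fun=> 1%N)) ?sum1_card ?card_ord // => v _; case: eqP.
  rewrite leq_add2r /edges_in.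
  under [X in (_ <= X)%N]eq_bigr => A _ do rewrite -sum1_count big_mkcond /=.
  rewrite exchange_big /= -sum1_count big_mkcond /=; apply: leq_sum => e _.
  case: ifP => // same; rewrite (bigD1 (finset.pblock P e.1)) /=.
    by rewrite !blockP eqxx same leq_addr.
  by apply: pblock_mem; rewrite (cover_partition partP) finset.in_setT.
apply: le_trans (proj2 (modularityP R G) P partP).
rewrite /modularity_of sumrB -!mulr_suml.
set M := size G; set K := (\sum_(v < n.+1) (f v != f (p v)))%N in edges_ge.
have {}cuts : (s * K <= 2 * M)%N.
  have -> : K = (\sum_(v < n.+1) (r v != r (p (inord v))))%N.
    by apply: eq_bigr => v _; rewrite inord_val.
  apply: leq_trans cuts _; rewrite -sum_mdeg.
  by apply: leq_sum => v _; rewrite inord_val.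
have MR : 0 < M%:R :> R by rewrite ltr0n.
have sR : 0 < s%:R :> R by rewrite ltr0n.
have KR : K%:R / M%:R <= 2 / s%:R :> R.
  rewrite ler_pdivrMr // mulrAC ler_pdivlMr // -!natrM ler_nat mulnC.
  by move: cuts.
have eR : n.+1%:R - K%:R <= \sum_(A in P) (edges_in G A)%:R :> R.
  by rewrite lerBlDr -natr_sum -natrD ler_nat.
have vR : \sum_(A in P) (\sum_(v in A) mdeg G v)%N%:R ^+ 2
    <= (1 + s%:R) * D%:R * (2 * M%:R) :> R.
  apply: (@le_trans _ _ (\sum_(A in P) B%:R * (\sum_(v in A) mdeg G v)%N%:R)).
    by apply: ler_sum => A /vol_le leB; rewrite expr2 ler_wpM2r // ler_nat.
  rewrite -mulr_sumr -natr_sum sum_vol [in leLHS]natrM ler_wpM2r ?mulr_ge0 //.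
  by rewrite natrD natrM mulrDl mul1r.
have e1 : (n.+1%:R - K%:R) / M%:R
    <= (\sum_(A in P) (edges_in G A)%:R) / M%:R :> R.
  by rewrite ler_pM2r ?invr_gt0.
have v1 : (\sum_(A in P) (\sum_(v in A) mdeg G v)%N%:R ^+ 2) / (4 * M%:R ^+ 2)
    <= (1 + s%:R) * D%:R / (2 * M%:R) :> R.
  rewrite ler_pdivrMr ?mulr_gt0 ?exprn_gt0 //; apply: le_trans vR _.
  rewrite le_eqVlt; apply/orP; left; apply/eqP; field.
  by rewrite gt_eqF.
rewrite mulrBl in e1; lra.
Qed.

(** * Structure of the preferential attachment graph *)

Lemma pa_graph1E (t : nat) (h : pa_choices t) :
  exists2 T : 'I_t -> 'I_t, (forall i, T i <= i)%N
    & pa_graph1 h = [seq (i, T i) | i <- rev (enum 'I_t)].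
Proof.
elim: t h => [|t IHt] => [[]|[h i]].
  by exists id => //=; rewrite (size0nil (size_enum_ord 0)).
have [T T_le TE] := IHt h.
pose T' j := if unlift ord_max j is Some k then lift ord_max (T k) else i.
have T'l k : T' (lift ord_max k) = lift ord_max (T k) by rewrite /T' liftK.
exists T' => [j|].
  rewrite /T'; case: unliftP => [k ->|->]; last by rewrite -ltnS.
  by rewrite !lift_max.
rewrite enum_ordSr rev_rcons map_cons {1}/T' unlift_none /= TE; congr (_ :: _).
rewrite -map_rev -!map_comp; apply: eq_map => k /=.
have -> : widen_ord (leqnSn t) k = lift ord_max k.
  by apply: val_inj; apply/esym/lift_max.
by rewrite T'l.
Qed.

(** The forest edge of v is the edge sent by the first of the m vertices of
    G_1^(nm) that are merged into v. *)
Lemma pa_graph_forest (m n : nat) (h : pa_choices (n * m)) :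
  (0 < m)%N ->
  exists2 p : 'I_n -> 'I_n, (forall v, p v <= v)%N
    & forall a : pred ('I_n * 'I_n),
        (count a [seq (v, p v) | v <- enum 'I_n] <= count a (pa_graph h))%N.
Proof.
move=> m_gt0; have [T T_le TE] := pa_graph1E h.
have first_subproof (v : 'I_n) : (v * m < n * m)%N by rewrite ltn_pmul2r.
pose first v := Ordinal (first_subproof v).
have firstK : cancel first (@block m n).
  by move=> v; apply: val_inj; rewrite /= mulnK.
exists (fun v => block (T (first v))) => [v|a].
  by rewrite -[X in (_ <= X)%N](mulnK v m_gt0) leq_div2r.
rewrite count_map count_enum /pa_graph TE -map_comp count_map count_rev count_enum.
pose F i := a (block i, block (T i)).
apply: (@leq_trans (\sum_v F (first v))%N).
  by apply: leq_sum => v _; rewrite /F firstK.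
have inj := can_inj firstK.
rewrite -(big_imset (fun i => nat_of_bool (F i)) (in2W inj)) /= big_mkcond /=.
by apply: leq_sum => i _; case: ifP.
Qed.

Lemma mdeg_pa_graph_le (m n D : nat) (h : pa_choices (n * m)) :
  (forall x, mdeg (pa_graph1 h) x <= D)%N ->
  forall v, (mdeg (pa_graph h) v <= m * D)%N.
Proof.
move=> degD v.
have -> : mdeg (pa_graph h) v = (\sum_(x | block x == v) mdeg (pa_graph1 h) x)%N.
  rewrite /mdeg exchange_big big_map /=; apply: eq_bigr => e _.
  have one (y : 'I_(n * m)) : ((block y == v) = \sum_(x | block x == v) (y == x) :> nat)%N.
    case: eqP => yv; last first.
      by rewrite big1 // => x /eqP xv; case: eqP => // yx; case: yv; rewrite yx.
    rewrite (bigD1 y) ?yv //= eqxx big1 // => x /andP[_ /negbTE].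
    by rewrite eq_sym => ->.
  by rewrite big_split /= -!one.
apply: (@leq_trans (\sum_(x : 'I_(n * m) | block x == v) D)%N).
  by apply: leq_sum => x _.
rewrite sum_nat_const leq_mul2r; apply/orP; right.
have [m0|m_gt0] := posnP m.
  rewrite (_ : #|_| = 0%N) //; apply: eq_card0 => -[x ltx]; exfalso.
  by move: ltx; rewrite m0 muln0.
pose f (x : 'I_(n * m)) : 'I_m := Ordinal (ltn_pmod x m_gt0).
rewrite -(card_in_imset (f := f)); last first.
  move=> x y xP yP [] xy; apply: val_inj.
  have /eqP xv : block x == v := xP.
  have /eqP yv : block y == v := yP.
  rewrite /= (divn_eq x m) (divn_eq y m) xy; congr (_ * _ + _)%N.
  by have /(congr1 val) := etrans xv (esym yv).
by rewrite -[X in (_ <= X)%N]card_ord max_card.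
Qed.

(** * Expectations under preferential attachment *)

Definition pa_E (R : realType) (t : nat) (f : pa_choices t -> R) : R :=
  \sum_h pa_weight R h * f h.

Lemma pa_Pr_le (R : realType) (t : nat) (E F : pred (pa_choices t)) :
  (forall h, E h -> F h) -> pa_Pr R E <= pa_Pr R F.
Proof.
move=> EF; rewrite /pa_Pr big_mkcond [leRHS]big_mkcond /=.
apply: ler_sum => h _; case: ifPn => [/EF->//|_].
by case: ifP => // _; exact: pa_weight_ge0.
Qed.

Lemma pa_Pr_le1 (R : realType) (t : nat) (E : pred (pa_choices t)) :
  pa_Pr R E <= 1.
Proof. by rewrite -(pa_Pr_setT R t); apply: pa_Pr_le. Qed.

Lemma pa_markov (R : realType) (t : nat) (f : pa_choices t -> R) (a : R) :
  0 < a -> (forall h, 0 <= f h) ->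
  1 - pa_E f / a <= pa_Pr R (fun h => f h < a).
Proof.
move=> a_gt0 f_ge0; rewrite lerBlDr -(pa_Pr_setT R t) /pa_Pr /pa_E.
rewrite mulr_suml [X in X + _]big_mkcond -big_split /=; apply: ler_sum => h _.
have w0 := pa_weight_ge0 R h; case: ltP => [_|le].
  by rewrite lerDl divr_ge0 ?mulr_ge0 // ltW.
by rewrite add0r -mulrA ler_peMr // ler_pdivlMr // mul1r.
Qed.

Lemma pa_E_S (R : realType) (t : nat) (f : pa_choices t.+1 -> R) :
  pa_E f = pa_E (fun h : pa_choices t =>
    (\sum_v (mdeg (pa_graph1 h) v)%:R * f (h, lift ord_max v) + f (h, ord_max))
      / (2 * t + 1)%:R).
Proof.
rewrite /pa_E /=.
rewrite (eq_bigr (fun x => pa_weight R x.1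
    * (pa_step R (pa_graph1 x.1) x.2 * f (x.1, x.2)))); last first.
  by move=> [h i] _; rewrite mulrA.
rewrite -(pair_big xpredT xpredT (fun h i =>
  pa_weight R h * (pa_step R (pa_graph1 h) i * f (h, i)))) /=.
apply: eq_bigr => h _; rewrite -mulr_sumr; congr (_ * _).
rewrite big_ord_recr /= {2}/pa_step unlift_none mulrDl mulr_suml.
congr (_ + _); last by rewrite mulrAC mul1r.
apply: eq_bigr => s _.
have -> : widen_ord (leqnSn t) s = lift ord_max s.
  by apply: val_inj; apply/esym/lift_max.
by rewrite /pa_step liftK mulrAC.
Qed.

Lemma mdeg_pa_graph1S (t : nat) (h : pa_choices t) (i : 'I_t.+1) :
  (forall v, mdeg (pa_graph1 (t := t.+1) (h, i)) (lift ord_max v)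
     = mdeg (pa_graph1 h) v + (i == lift ord_max v))%N
  /\ mdeg (pa_graph1 (t := t.+1) (h, i)) ord_max = (i == ord_max).+1.
Proof.
rewrite /mdeg /=; split=> [v|]; rewrite big_cons big_map /=.
  rewrite (negbTE (neq_lift _ _)) add0n addnC; congr (_ + _)%N.
  by apply: eq_bigr => e _; rewrite !(inj_eq lift_inj).
rewrite eqxx big1 ?addn0 // => e _.
by rewrite !(eq_sym (lift _ _)) !(negbTE (neq_lift _ _)).
Qed.

(** * Rising moments of the degrees *)

(** 'C(d + l, l.+1) is the rising factorial d (d + 1) ... (d + l) divided by
    l.+1`!. Unlike the power d ^ l.+1, it grows in expectation by an exact
    multiple of itself when d increases by 1 with probability proportional
    to d. *)
Definition pa_moment (l t : nat) (h : pa_choices t) : nat :=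
  (\sum_v 'C(mdeg (pa_graph1 h) v + l, l.+1))%N.

(** By Pascal's rule the vertex hit by the new edge gains 'C(d + l, l), and
    the new vertex, of degree 1 or 2, contributes at most l.+2. *)
Lemma pa_momentS (l t : nat) (h : pa_choices t) (i : 'I_t.+1) :
  (pa_moment l (t := t.+1) (h, i) <= pa_moment l h + l.+2
     + \sum_v (i == lift ord_max v) * 'C(mdeg (pa_graph1 h) v + l, l))%N.
Proof.
have [degl degm] := mdeg_pa_graph1S h i.
rewrite /pa_moment big_ord_recr /= addnAC leq_add //; last first.
  rewrite degm; case: (i == _) => /=; rewrite ?add2n ?add1n ?binn //.
  by rewrite binSn.
rewrite -big_split /=; apply: leq_sum => v _.
have -> : widen_ord (leqnSn t) v = lift ord_max v.
  by apply: val_inj; apply/esym/lift_max.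
rewrite degl; case: (i == _); last by rewrite addn0 addn0.
by rewrite addn1 addSn binS mul1n.
Qed.

(** The degree-weighted sum of the gains 'C(d + l, l) is l.+1 times the moment,
    because d * 'C(d + l, l) = l.+1 * 'C(d + l, l.+1). *)
Lemma pa_E_moment_step (R : realType) (l t : nat) :
  pa_E (fun h : pa_choices t.+1 => (pa_moment l h)%:R : R)
    <= (2 * t + 1 + l.+1)%:R / (2 * t + 1)%:R
         * pa_E (fun h : pa_choices t => (pa_moment l h)%:R) + l.+2%:R.
Proof.
have total : \sum_(h : pa_choices t) pa_weight R h = 1 := pa_Pr_setT R t.
have -> : l.+2%:R = l.+2%:R * \sum_(h : pa_choices t) pa_weight R h :> R.
  by rewrite total mulr1.
rewrite pa_E_S /pa_E !mulr_sumr.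
rewrite -big_split; apply: ler_sum => h _ /=.
rewrite [l.+2%:R * _]mulrC [in leRHS]mulrCA -mulrDr ler_wpM2l ?pa_weight_ge0 //.
have c0 : 0 < (2 * t + 1)%:R :> R by rewrite ltr0n addn1.
rewrite ler_pdivrMr // mulrDl mulrAC divfK ?gt_eqF //.
under eq_bigr => v _ do rewrite -natrM.
rewrite -natr_sum -!natrM -!natrD ler_nat.
pose d v := mdeg (pa_graph1 h) v.
pose M := pa_moment l h.
have at_lift v : (pa_moment l (t := t.+1) (h, lift ord_max v)
    <= M + l.+2 + 'C(d v + l, l))%N.
  apply: leq_trans (pa_momentS l h _) _; rewrite leq_add2l (bigD1 v) //=.
  rewrite eqxx mul1n big1 ?addn0 // => u; rewrite (inj_eq lift_inj) eq_sym.
  by move/negbTE->.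
have at_max : (pa_moment l (t := t.+1) (h, ord_max) <= M + l.+2)%N.
  apply: leq_trans (pa_momentS l h _) _; rewrite big1 ?addn0 // => u _.
  by rewrite (negbTE (neq_lift _ _)).
have sum_d : (\sum_v d v = 2 * t)%N by rewrite sum_mdeg size_pa_graph1.
have weighted : (\sum_v d v * 'C(d v + l, l) = l.+1 * M)%N.
  rewrite big_distrr /=; apply: eq_bigr => v _.
  by rewrite mul_bin_left addnK.
apply: (@leq_trans (\sum_v d v * (M + l.+2 + 'C(d v + l, l)) + (M + l.+2))%N).
  by rewrite leq_add // leq_sum // => v _; rewrite leq_mul2l at_lift orbT.
rewrite (eq_bigr (fun v => d v * (M + l.+2) + d v * 'C(d v + l, l)))%N; last first.
  by move=> v _; rewrite mulnDr.
rewrite big_split /= -big_distrl /= sum_d weighted -/M; lia.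
Qed.

(** For the even order l.*2.+2 the product, as a function of t, is a solution
    of the homogeneous recurrence: passing from t to t.+1 shifts its factors
    by one place, so it is multiplied by (2t + 1 + l.*2.+2) / (2t + 1). The
    factor t absorbs the contributions of the t new vertices. *)
Lemma pa_E_moment_le (R : realType) (l t : nat) :
  pa_E (fun h : pa_choices t => (pa_moment l.*2.+1 h)%:R : R)
    <= (l.*2.+3 * t * \prod_(j < l.+1) (2 * t + 1 + 2 * j))%:R.
Proof.
elim: t => [|t IHt].
  rewrite /pa_E big1 // => h _; rewrite /pa_moment big_ord0 mulr0 //.
apply: le_trans (pa_E_moment_step R _ t) _.
pose P u := (\prod_(j < l.+1) (2 * u + 1 + 2 * j))%N.
rewrite -/(P t) in IHt; rewrite -/(P t.+1).
have P_gt0 u : (0 < P u)%N.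
  by rewrite prodn_gt0 // => j; rewrite addn1 addSn.
have PS : ((2 * t + 1) * P t.+1 = P t * (2 * t + 1 + l.*2.+2))%N.
  rewrite /P big_ord_recr big_ord_recl /= muln0 addn0 -mulnA; congr (_ * _)%N.
  congr (_ * _)%N; last by lia.
  by apply: eq_bigr => j _; rewrite /bump /=; lia.
have c0 : 0 < (2 * t + 1)%:R :> R by rewrite ltr0n addn1.
apply: (@le_trans _ _ ((l.*2.+3 * t * P t.+1)%:R + l.*2.+3%:R)).
  rewrite lerD2r mulrAC ler_pdivrMr // -natrM.
  have -> : (l.*2.+3 * t * P t.+1 * (2 * t + 1)
     = (2 * t + 1 + l.*2.+2) * (l.*2.+3 * t * P t))%N.
    by rewrite -mulnA [(P t.+1 * _)%N]mulnC PS mulnA mulnC.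
  by rewrite natrM ler_wpM2l.
rewrite -natrD ler_nat; have := P_gt0 t.+1; nia.
Qed.

(** * Maximum degree *)

Lemma expn_le_bin (d l : nat) : (d ^ l.+1 <= l.+1`! * 'C(d + l, l.+1))%N.
Proof.
rewrite mulnC bin_ffact; elim: l => [|l IHl].
  by rewrite addn0 expn1 ffactn1.
by rewrite expnS addnS ffactSS leq_mul // ltnW // ltnS leq_addr.
Qed.

Lemma pa_moment_ge (l t : nat) (h : pa_choices t) (v : 'I_t) :
  (mdeg (pa_graph1 h) v ^ l.+1 <= l.+1`! * pa_moment l h)%N.
Proof.
apply: leq_trans (expn_le_bin _ l) _.
by rewrite leq_mul2l /pa_moment (bigD1 v) //= leq_addr orbT.
Qed.

(** The expected moment of order 2a is O(n^(a + 1)), while the power 2a of the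
    threshold is n^(a + 4ea). The choice 4ea >= 2 leaves a factor 1 / n. *)
Lemma pa_maxdeg_tail (R : realType) (m : nat) (e : R) :
  0 < e ->
  exists D : R, forall n : nat, (0 < n)%N ->
    1 - D / n%:R <= pa_Pr R (fun h : pa_choices (n * m) =>
      [forall v, (mdeg (pa_graph1 h) v)%:R < n%:R `^ (1 / 2 + 2 * e)]).
Proof.
move=> e_gt0; pose l := Num.truncn (1 / (2 * e)); pose a := l.+1; pose k := l.*2.+1.
have a_ge : 2 <= 4 * e * a%:R.
  have : 1 / (2 * e) < a%:R by apply: truncnS_gt.
  rewrite ltr_pdivrMr; last lra.
  by move=> ?; lra.
pose D := (k.+1`! * (k.+2 * m * (2 * m + 2 * a) ^ a))%N; exists D%:R => n n_gt0.
have nR : 1 <= n%:R :> R by rewrite ler1n.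
set x := n%:R `^ _.
have x_gt0 : 0 < x by apply: powR_gt0; rewrite ltr0n.
have xk : n%:R ^+ a.+2 <= x ^+ k.+1.
  rewrite -!powR_mulrn ?ler0n ?powR_ge0 // -powRrM; apply: ler_powR => //.
  have -> : k.+1 = (2 * a)%N by rewrite /k /a; lia.
  by rewrite natrM -[a.+2]addn2 natrD; lra.
have fact_gt0 : 0 < (k.+1`!)%:R :> R by rewrite ltr0n fact_gt0.
apply: (@le_trans _ _ (pa_Pr R (fun h : pa_choices (n * m) =>
    (pa_moment k h)%:R < x ^+ k.+1 / k.+1`!%:R))); last first.
  apply: pa_Pr_le => h lt; apply/forallP => v; rewrite ltNge; apply/negP => le.
  have := pa_moment_ge k h v; apply/negP; rewrite -ltnNge -(ltr_nat R).
  rewrite natrM mulrC natrX -ltr_pdivlMr //; apply: lt_le_trans lt _.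
  by rewrite ler_pM2r ?invr_gt0 // lerXn2r ?nnegrE ?ler0n // ltW.
apply: (le_trans _ (pa_markov (f := fun h => (pa_moment k h)%:R) _ _)) => //; last first.
  by rewrite divr_gt0 ?exprn_gt0.
rewrite lerD2l lerN2 invf_div mulrA ler_pdivrMr ?exprn_gt0 //.
apply: (@le_trans _ _ (D%:R / n%:R * n%:R ^+ a.+2)); last first.
  by rewrite ler_wpM2l ?divr_ge0.
rewrite exprS mulrA divfK ?gt_eqF ?ltr0n //.
rewrite /D natrM -!mulrA mulrC ler_wpM2l //.
apply: le_trans (pa_E_moment_le R l (n * m)) _.
rewrite -natrX -natrM ler_nat -/a.
have prod_le : (\prod_(j < a) (2 * (n * m) + 1 + 2 * j)
    <= (2 * m + 2 * a) ^ a * n ^ a)%N.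
  rewrite -expnMn -[X in (_ ^ X)%N](card_ord a) -prod_nat_const.
  apply: leq_prod => j _; have := ltn_ord j; nia.
rewrite expnS.
apply: (@leq_trans (k.+2 * (n * m) * ((2 * m + 2 * a) ^ a * n ^ a))%N).
  by rewrite leq_mul2l prod_le orbT.
by apply: eq_leq; ring.
Qed.

(** * Modularity of the preferential attachment graph *)

(** With u = n^(1/4 - e) and degrees below x = n^(1/2 + 2e), one has
    n = x * u ^+ 2, so that cutting at s close to u makes both the fraction of
    cut edges and the degree tax at most 2 / u. *)
Lemma pa_modularity_ge (R : realType) (m : nat) (e : R) :
  (0 < m)%N -> 0 < e -> e <= 1 / 4 ->
  exists D : R, forall n : nat, (0 < n)%N ->
    1 - D / n%:R <= pa_Pr R (fun h : pa_choices (n * m) =>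
      m%:R^-1 - 4 * n%:R `^ (- (1 / 4) + e) <= modularity R (pa_graph h)).
Proof.
move=> m_gt0 e_gt0 e_le; have [D tail] := pa_maxdeg_tail m e_gt0.
exists D => n n_gt0; apply: le_trans (tail n n_gt0) _.
apply: pa_Pr_le => h /forallP degx.
set x := n%:R `^ _ in degx; pose u : R := n%:R `^ (1 / 4 - e).
have nR : 1 <= n%:R :> R by rewrite ler1n.
have n_neq0 : n%:R != 0 :> R by rewrite gt_eqF // ltr0n.
have u_ge1 : 1 <= u by rewrite -[leLHS](powRr0 n%:R) ler_powR //; lra.
have x_gt0 : 0 < x by apply: powR_gt0; rewrite ltr0n.
have uV : n%:R `^ (- (1 / 4) + e) = u^-1 by rewrite -powRN; congr (_ `^ _); lra.
have nE : n%:R = x * u ^+ 2.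
  rewrite -powR_mulrn ?powR_ge0 // -powRrM -powRD ?n_neq0 ?implybT //.
  by rewrite -[LHS]powRr1 ?ler0n //; congr (_ `^ _); lra.
pose s := (Num.truncn u).+1; pose d := Num.truncn x.
have s_gt : u < s%:R by apply: truncnS_gt.
have s_le : s%:R <= u + 1.
  by rewrite -natr1 lerD2r truncn_le //; lra.
have d_le : d%:R <= x by rewrite truncn_le // ltW.
have deg_d v : (mdeg (pa_graph1 h) v <= d)%N.
  by rewrite /d truncn_ge_nat ?ltW.
have [p p_le p_sub] := pa_graph_forest h m_gt0.
have sizeG : size (pa_graph h) = (n * m)%N by rewrite size_map size_pa_graph1.
have := modularity_forest_ge R (D := m * d) (s := s) isT _ p_le p_sub
  (mdeg_pa_graph_le deg_d).
rewrite sizeG muln_gt0 n_gt0 m_gt0 => /(_ isT); apply: le_trans.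
have mR : 0 < m%:R :> R by rewrite ltr0n.
have -> : n%:R / (n * m)%:R = m%:R^-1 :> R.
  by rewrite natrM; field; rewrite n_neq0 gt_eqF.
have -> : (1 + s%:R) * (m * d)%:R / (2 * (n * m)%:R)
    = (1 + s%:R) * d%:R / (2 * n%:R) :> R.
  by rewrite !natrM; field; rewrite n_neq0 gt_eqF.
have cut_le : 2 / s%:R <= 2 * u^-1.
  by rewrite ler_wpM2l // lef_pV2 ?posrE ?ltW //; lra.
have vol_le : (1 + s%:R) * d%:R / (2 * n%:R) <= 2 * u^-1.
  rewrite ler_pdivrMr; last by lra.
  have -> : 2 * u^-1 * (2 * n%:R) = 4 * u * x.
    by rewrite nE; field; rewrite gt_eqF //; lra.
  by apply: ler_pM => //; lra.
rewrite uV; lra.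
Qed.

Lemma pa_aas_rate (R : realType) (m : nat)
    (E : forall n : nat, pred (pa_choices (n * m))) (D : R) :
  (forall n, (0 < n)%N -> 1 - D / n%:R <= pa_Pr R (E n)) -> pa_aas R E.
Proof.
move=> lower; rewrite /pa_aas -cvg_shiftS.
apply: (@squeeze_cvgr _ _ _ _ (fun n => 1 - D * harmonic n) (fun=> 1)).
- by apply: nearW => n /=; rewrite pa_Pr_le1 lower.
- have lim : ((fun n => 1 - D * harmonic n) @ \oo --> (1 - D * 0 : R))%classic.
    by apply: cvgB; [exact: cvg_cst | apply: cvgMr; exact: cvg_harmonic].
  by move: lim; rewrite mulr0 subr0.
- exact: cvg_cst.
Qed.

Unset Implicit Arguments.

Theorem theorem10 (R : realType) (m : nat) (hm : (1 <= m)%N)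
    (eps : R) (heps : 0 < eps) :
  (exists C : R,
     pa_aas R (fun (n : nat) (h : pa_choices (n * m)) =>
       m%:R^-1 - C * n%:R `^ (- (1 / 4) + eps) <= modularity R (pa_graph h)))
  /\ (exists delta : nat -> R,
        (delta @ \oo --> (0 : R))%classic
        /\ pa_aas R (fun (n : nat) (h : pa_choices (n * m)) =>
             m%:R^-1 - delta n <= modularity R (pa_graph h))).
Proof.
(* The rate with e is at least as good as the one with eps, and it tends to 0
   even when eps is at least 1 / 4. *)
pose e := Num.min eps (1 / 8).
have e_gt0 : 0 < e by rewrite lt_min heps; lra.
have e_le : e <= 1 / 8 by rewrite ge_min lexx orbT.
have e_eps : e <= eps by rewrite ge_min lexx.
have e_lt : 0 < 1 / 4 - e by lra.
have e_le4 : e <= 1 / 4 by lra.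
have [D lower] := pa_modularity_ge hm e_gt0 e_le4.
split.
- exists 4; apply: (@pa_aas_rate _ _ _ D) => n n_gt0.
  apply: le_trans (lower n n_gt0) _; apply: pa_Pr_le => h; apply: le_trans.
  rewrite lerD2l lerN2 ler_wpM2l // ler_powR ?ler1n //; lra.
- exists (fun n => 4 * n%:R `^ (- (1 / 4) + e)); split; last exact: pa_aas_rate lower.
  have /cvg_at_rightP/(_ (@harmonic R)) := powR_cvg0 e_lt.
  have pos n : 0 < @harmonic R n by rewrite /harmonic /= invr_gt0 ltr0n.
  move=> /(_ (conj pos cvg_harmonic)) /(cvgMr (a := 4)).
  rewrite mulr0 => lim; rewrite -cvg_shiftS; apply: cvg_trans lim.
  apply: near_eq_cvg; apply: nearW => n /=; congr (4 * _).
  by rewrite -[n.+1%:R^-1]powR_inv1 ?ler0n // -powRrM; congr (_ `^ _); lra.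
Qed.
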